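(* For every $d \ge 1$ there is a non-evasive simplicial $d$-complex $E_d$ with exactly two free faces, and these two free faces share a common codimension-one face.
   Context: A face $\sigma$ of a simplicial complex $C$ is free if it is properly contained in exactly one other face of $C$. Non-evasiveness is defined recursively: a single vertex is non-evasive, and a simplicial complex $C$ with more than one vertex is non-evasive if there is a vertex $v$ of $C$ such that both the link $\mathrm{lk}_C(v)$ and the deletion $C - v$ (the subcomplex of faces not containing $v$) are non-evasive. *)

(* Defs.v *)
From mathcomp Require Import all_boot.
Set Implicit Arguments.
Unset Strict Implicit.
Unset Printing Implicit Defensive.

Section Complexes.
Variable T : finType.
Implicit Types (C : {set {set T}}) (r s t : {set T}) (v : T).

(* The empty set is a face. Elements of T need not be vertices of C. *)
Definition simplicial_complex C : Prop :=
  set0 \in C /\ forall s t, t \in C -> s \subset t -> s \in C.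

Definition vertices C : {set T} := [set v | [set v] \in C].

Definition link C v : {set {set T}} := [set s in C | (v \notin s) && (v |: s \in C)].

Definition deletion C v : {set {set T}} := [set s in C | v \notin s].

(* A face with k.+1 elements has dimension k. *)
Definition has_dimension C (d : nat) : Prop := \max_(s in C) #|s| = d.+1.

Definition free_face C s : bool :=
  (s \in C) && (#|[set t in C | s \proper t]| == 1).

(* Codimension one is relative to s. For a vertex s this allows r = set0. *)
Definition codim1_face C r s : bool :=
  [&& r \in C, r \subset s & #|s| == #|r|.+1].

Inductive nonevasive : {set {set T}} -> Prop :=
| nonevasive_point v : nonevasive [set set0; [set v]]
| nonevasive_step C v :
    1 < #|vertices C| -> v \in vertices C ->
    nonevasive (link C v) -> nonevasive (deletion C v) -> nonevasive C.

Lemma deletion_complex C v :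
  simplicial_complex C -> simplicial_complex (deletion C v).
Proof.
case=> C0 Cs; split=> [|s t]; first by rewrite inE C0 inE.
rewrite !inE => /andP[Ct vt] st; rewrite (Cs _ _ Ct st).
by apply: contra vt; apply: (subsetP st).
Qed.

Lemma link_complex C v :
  simplicial_complex C -> v \in vertices C -> simplicial_complex (link C v).
Proof.
case=> C0 Cs; rewrite inE => Cv; split=> [|s t].
  by rewrite inE C0 inE setU0 Cv.
rewrite !inE => /and3P[Ct vt Cvt] st.
rewrite (Cs _ _ Ct st) (Cs _ _ Cvt (setUS _ st)) andbT.
by apply: contra vt; apply: (subsetP st).
Qed.

End Complexes.

(* Main.v *)
(* Coning over a non-evasive subcomplex L of a non-evasive complex D, with a new
   apex v, gives a non-evasive complex D u v*L.  If L contains every free face of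
   D and no facet of D, then the free faces of D u v*L are the v u s with s free
   in L.  So it suffices to have a tower A_0 < A_1 < ... < A_d, dim A_i = i, where
   A_0 is two points, A_i contains every free face and no facet of A_(i+1), and
   each A_i with i > 0 is non-evasive with two adjacent free faces.  From such a
   tower and two new vertices v, w one gets a tower that is one step longer:
     A'_0 = A_0,                          A'_1 = A_0 u w*A_0,
     A'_2 = (A_2 u v*A_1) u w*(A_0 u v*A_0),
     A'_(i+1) = {v,w}*A_i u vw*A_(i-1)    for i > 1,
   where the free faces of A'_(i+1) are the vw u s with s free in A_(i-1).
   A tower of length 2 comes from a 2-complex on six vertices whose only free
   faces are two edges with a common vertex: A_1 is the path they form. *)
Require Import Defs.
From mathcomp Require Import all_boot.
Set Implicit Arguments.
Unset Strict Implicit.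
Unset Printing Implicit Defensive.

(** * Attaching a cone: faces, link, deletion and non-evasiveness *)

Section Attach.
Variable T : finType.
Implicit Types (C D L X Y Z : {set {set T}}) (r s t u : {set T}) (v w x y : T).

Definition avoids v C : Prop := forall s : {set T}, s \in C -> v \notin s.

(* The union of D with the cone v * L. *)
Definition attach v D L : {set {set T}} :=
  [set s : {set T} | if v \in s then s :\ v \in L else s \in D].

Lemma attach_base v D L s : v \notin s -> (s \in attach v D L) = (s \in D).
Proof. by move=> vs; rewrite inE (negPf vs). Qed.

Lemma attach_cone v D L s :
  v \notin s -> (v |: s \in attach v D L) = (s \in L).
Proof. by move=> vs; rewrite inE setU11 setU1K. Qed.

Lemma setD1_id v s : v \notin s -> s :\ v = s.
Proof. by move=> vs; apply/setDidPl; rewrite disjoint_sym disjoints1. Qed.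

(** Erasing [v] changes nothing when [v] is absent, so both cases can test [s :\ v]. This uniform
    form lets nested attachments be evaluated by rewriting. *)
Lemma mem_attach v D L s :
  (s \in attach v D L) = (s :\ v \in if v \in s then L else D).
Proof. by rewrite inE; case: ifPn => // /setD1_id ->. Qed.

Lemma setD1C v w s : s :\ v :\ w = s :\ w :\ v.
Proof. by rewrite !setDDl setUC. Qed.

Lemma sub_avoids v C D : C \subset D -> avoids v D -> avoids v C.
Proof. by move=> /subsetP CD vD s /CD/vD. Qed.

Lemma avoids_attach v w D L :
  v != w -> avoids v D -> avoids v L -> avoids v (attach w D L).
Proof.
move=> vw vD vL s; rewrite inE; case: ifP => [ws /vL|_ /vD //].
by rewrite !inE vw.
Qed.

Lemma attach_complex v D L :
  avoids v D -> L \subset D -> simplicial_complex D -> simplicial_complex L ->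
  simplicial_complex (attach v D L).
Proof.
move=> vD /subsetP LD [D0 Dc] [L0 Lc]; split; first by rewrite !inE.
move=> s t; rewrite !inE; case: ifP => vt tC st; last first.
  have vs : v \notin s by apply/negP => /(subsetP st); rewrite vt.
  by rewrite (negPf vs) (Dc _ t).
case: ifP => vs; first by rewrite (Lc _ (t :\ v)) ?setSD.
by rewrite (Dc _ (t :\ v)) ?LD // subsetD1 st vs.
Qed.

Lemma attach_link v D L :
  L \subset D -> avoids v D -> link (attach v D L) v = L.
Proof.
move=> LD vD; apply/setP => s; rewrite inE.
case: (boolP (v \in s)) => [vs|vs] /=.
  by rewrite andbF; apply/esym/negP => /(subsetP LD)/vD; rewrite vs.
rewrite attach_base // attach_cone //.
by case: (boolP (s \in L)) => [/(subsetP LD) ->|_]; rewrite ?andbF.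
Qed.

Lemma attach_deletion v D L : avoids v D -> deletion (attach v D L) v = D.
Proof.
move=> vD; apply/setP => s; rewrite inE.
case: (boolP (v \in s)) => [vs|vs] /=; rewrite ?andbF ?andbT ?attach_base //.
by apply/esym/negP => /vD; rewrite vs.
Qed.

Lemma nonevasive_vertex C : nonevasive C -> exists v, v \in vertices C.
Proof. by case=> [v|C' v _ vC' _ _]; exists v; rewrite // inE set22. Qed.

(** The vertex to remove is [v]: its link is [L] and its deletion is [D]. The second vertex that the
    recursive clause asks for comes from [D]. *)
Lemma nonevasive_attach v D L :
  avoids v D -> L \subset D -> set0 \in L -> nonevasive D -> nonevasive L ->
  nonevasive (attach v D L).
Proof.
move=> vD LD L0 nD nL; have [u uD] := nonevasive_vertex nD.
have uv : u != v.
  by move: uD; rewrite inE => /vD; rewrite inE eq_sym.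
have vV : v \in vertices (attach v D L).
  by rewrite inE -[[set v]]setU0 attach_cone ?inE.
apply: (@nonevasive_step _ _ v) => //.
- apply/card_gt1P; exists u, v; split=> //.
  by rewrite [_ \in vertices _]inE attach_base;
    [move: uD; rewrite inE | rewrite !inE eq_sym].
- by rewrite attach_link.
- by rewrite attach_deletion.
Qed.

(** * Dimension of an attached cone *)

Lemma dimension_intro C d :
  (forall s, s \in C -> #|s| <= d.+1) -> (exists2 s, s \in C & #|s| = d.+1) ->
  has_dimension C d.
Proof.
move=> Cd [s sC sd]; apply/eqP; rewrite eqn_leq -{2}sd leq_bigmax_cond // andbT.
exact/bigmax_leqP.
Qed.

Lemma dimension_leq C d s : has_dimension C d -> s \in C -> #|s| <= d.+1.
Proof. by move=> <- sC; rewrite leq_bigmax_cond. Qed.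

Lemma dimension_attained C d :
  has_dimension C d -> exists2 s, s \in C & #|s| = d.+1.
Proof.
move=> Cd; have C0 : 0 < #|C|.
  rewrite lt0n; apply/eqP => /cards0_eq C0.
  by move: Cd; rewrite /has_dimension C0 big_set0.
have [s sC sd] := eq_bigmax_cond (fun s : {set T} => #|s|) C0.
by exists s => //; rewrite -sd.
Qed.

Lemma attach_dimension v D L d e :
  avoids v L -> has_dimension D d -> has_dimension L e -> d <= e.+1 ->
  has_dimension (attach v D L) e.+1.
Proof.
move=> vL Dd Le de; apply: dimension_intro => [s|].
  rewrite inE; case: ifP => [vs /(dimension_leq Le)|_ /(dimension_leq Dd) sd].
    by rewrite [in #|s|](cardsD1 v s) vs.
  exact: leq_trans sd _.
have [s sL se] := dimension_attained Le; exists (v |: s).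
  by rewrite attach_cone ?vL.
by rewrite cardsU1 vL // se.
Qed.

(** * Free faces of an attached cone *)

Lemma proper_setU1 v s : v \notin s -> s \proper v |: s.
Proof. by move=> vs; rewrite properE subsetUr subUset sub1set negb_and vs. Qed.

Lemma proper_setU1S v s t :
  v \notin t -> s \proper t -> v |: s \proper v |: t.
Proof.
move=> vt /properP[st [u ut us]]; apply/properP; split; first exact: setUS.
exists u; rewrite !inE ?ut ?orbT // negb_or us andbT.
by apply: contraNneq vt => <-.
Qed.

Lemma proper_setD1S v s t :
  v \in s -> v \in t -> (s \proper t) = (s :\ v \proper t :\ v).
Proof.
move=> vs vt; apply/idP/idP => [/properP[st [u ut us]]|st].
  apply/properP; split; first exact: setSD.
  exists u; rewrite !inE ?ut ?andbT; last by rewrite (negPf us) andbF.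
  by apply: contraNneq us => ->.
by rewrite -(setD1K vs) -(setD1K vt) proper_setU1S // !inE eqxx.
Qed.

(** Every coface of [s] contains [v], so adding [v] is a bijection from the proper cofaces of
    [s :\ v] in [L] to those of [s]. *)
Lemma free_attach_cone v D L s :
  avoids v L -> v \in s -> free_face (attach v D L) s = free_face L (s :\ v).
Proof.
move=> vL vs; rewrite /free_face inE vs; congr (_ && (_ == _)).
have -> : [set t in attach v D L | s \proper t] =
    (fun t => v |: t) @: [set t in L | s :\ v \proper t].
  apply/setP => t; apply/idP/imsetP => [|[t0]]; rewrite !inE.
    case/andP=> + st; have vt := subsetP (proper_sub st) _ vs.
    rewrite vt => tL; exists (t :\ v); last by rewrite setD1K.
    by rewrite inE tL -proper_setD1S.
  case/andP=> t0L st ->; rewrite setU11 setU1K ?vL // t0L.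
  by rewrite (proper_setD1S vs) ?setU11 // setU1K ?vL.
rewrite card_in_imset // => t1 t2; rewrite !inE => /andP[/vL v1 _] /andP[/vL v2 _].
by move=> /(congr1 (fun t => t :\ v)); rewrite !setU1K.
Qed.

(* A proper coface of s in D and v |: s are two cofaces of a face s of L. *)
Lemma free_attach_link v D L s t :
  avoids v D -> L \subset D -> s \in L -> t \in D -> s \proper t ->
  ~~ free_face (attach v D L) s.
Proof.
move=> vD LD sL tD st; rewrite negb_and; apply/orP; right.
have vs : v \notin s by rewrite vD ?(subsetP LD).
rewrite neq_ltn; apply/orP; right; apply/card_gt1P; exists t, (v |: s); split.
- by rewrite inE attach_base ?vD // tD.
- by rewrite inE attach_cone // sL proper_setU1.
- by apply: contraNneq (vD t tD) => ->; rewrite setU11.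
Qed.

(** A coface of [s] through [v] would be [v |: t] with [t] in [L] containing [s], which would put
    [s] in [L]. So [s] has the same cofaces as in [D]. *)
Lemma free_attach_base v D L s :
  avoids v D -> simplicial_complex L -> v \notin s -> s \notin L ->
  free_face (attach v D L) s = free_face D s.
Proof.
move=> vD [_ Lc] vs sL; rewrite /free_face attach_base //.
suff -> : [set t in attach v D L | s \proper t] = [set t in D | s \proper t] by [].
apply/setP => t; rewrite !inE; case: ifP => // vt.
have [st|] := boolP (s \proper t); rewrite ?andbF // !andbT.
have sub : s \subset t :\ v by rewrite subsetD1 proper_sub.
rewrite (negPf (contra (fun tL => Lc _ _ tL sub) sL)).
by apply/esym/negP => /vD; rewrite vt.
Qed.

(** The relation between consecutive stages of a tower. The second clause says that no facet of [D]
    lies in [L]. *)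
Definition covers L D : Prop :=
  [/\ L \subset D,
      forall s, s \in L -> exists2 t, t \in D & s \proper t &
      forall s, free_face D s -> s \in L].

(** Three cases: a face through [v] behaves as in [L]; a face of [L] has one coface in [D] and
    another through [v]; any other face keeps its cofaces from [D], where all free faces lie in
    [L]. *)
Lemma free_attach v D L s :
  avoids v D -> simplicial_complex L -> covers L D ->
  free_face (attach v D L) s = (v \in s) && free_face L (s :\ v).
Proof.
move=> vD Lcx [LD Lp Lf]; have vL := sub_avoids LD vD.
have [vs|vs] /= := boolP (v \in s); first exact: free_attach_cone.
apply/negbTE; have [sL|sL] := boolP (s \in L).
  by have [t tD st] := Lp s sL; apply: free_attach_link st.
by rewrite free_attach_base //; apply: contra sL => /Lf.
Qed.

Definition adjacent_free C : Prop := exists s t : {set T},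
  [/\ s != t, [set u | free_face C u] = [set s; t] &
      exists r : {set T}, codim1_face C r s /\ codim1_face C r t].

(** Adding [v] to the two free faces and to their common face keeps them distinct and preserves the
    codimension. *)
Lemma adjacent_free_cone v C X :
  avoids v C -> (forall s, s \in C -> v |: s \in X) ->
  (forall s, free_face X s = (v \in s) && free_face C (s :\ v)) ->
  adjacent_free C -> adjacent_free X.
Proof.
move=> vC CX fX [s [t [st fC [r [rs rt]]]]].
have inC u : u \in [set s; t] -> u \in C by rewrite -fC inE => /andP[].
have sC : s \in C by rewrite inC ?set21.
have tC : t \in C by rewrite inC ?set22.
exists (v |: s), (v |: t); split.
- apply: contra st => /eqP/(congr1 (fun u => u :\ v)).
  by rewrite !setU1K ?vC // => ->.
- apply/setP => u; rewrite inE fX; apply/andP/set2P => [[vu]|].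
    move=> fu; have : u :\ v \in [set s; t] by rewrite -fC inE.
    by move=> /set2P[] <-; rewrite setD1K //; [left|right].
  have fs (u0 : {set T}) : u0 \in [set s; t] -> free_face C u0 by rewrite -fC inE.
  by case=> ->; rewrite setU11 setU1K ?vC ?fs ?set21 ?set22.
exists (v |: r).
have cone u : u \in C -> codim1_face C r u -> codim1_face X (v |: r) (v |: u).
  move=> uC /and3P[rC ru ur]; apply/and3P; split; first exact: CX.
    exact: setUS.
  by rewrite !cardsU1 !vC.
by split; apply: cone.
Qed.

Lemma attach_sub v D L D' L' :
  D \subset D' -> L \subset L' -> attach v D L \subset attach v D' L'.
Proof.
move=> /subsetP DD /subsetP LL; apply/subsetP => s; rewrite !inE.
by case: ifP => _; [apply: LL|apply: DD].
Qed.

Lemma sub_attach v D L : avoids v D -> D \subset attach v D L.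
Proof. by move=> vD; apply/subsetP => s sD; rewrite attach_base ?vD. Qed.

(** * Lifting a tower by two vertices *)

(* Suspension of Z with apexes v and w, glued with (edge vw) * Y. *)
Definition lift v w Y Z : {set {set T}} :=
  attach v (attach w Z Z) (attach w Z Y).

(* The bottom step is different because [lift v w X Y] is a 2-sphere when Y is a
   path with endpoints X. *)
Definition midlift v w X Y Z : {set {set T}} :=
  attach w (attach v Z Y) (attach v X X).

Lemma mem_lift v w Y Z s :
  v != w ->
  (s \in lift v w Y Z) =
  (s :\ v :\ w \in if (v \in s) && (w \in s) then Y else Z).
Proof.
move=> vw; rewrite mem_attach; case: (v \in s); rewrite mem_attach !inE 1?eq_sym vw //=.
by case: ifP.
Qed.

Section Lift.
Variables (v w : T) (X Y Z : {set {set T}}).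
Hypotheses (vw : v != w) (vZ : avoids v Z) (wZ : avoids w Z).
Hypotheses (Xcx : simplicial_complex X) (Ycx : simplicial_complex Y).
Hypotheses (Zcx : simplicial_complex Z) (XY : covers X Y) (YZ : covers Y Z).

Let XsY : X \subset Y. Proof. by case: XY. Qed.
Let YsZ : Y \subset Z. Proof. by case: YZ. Qed.
Let vY := sub_avoids YsZ vZ.
Let wY := sub_avoids YsZ wZ.
Let vX := sub_avoids XsY vY.
Let wX := sub_avoids XsY wY.
Let wv : w != v. Proof. by rewrite eq_sym. Qed.
Let linkcx : simplicial_complex (attach w Z Y).
Proof. exact: attach_complex. Qed.
Let delcx : simplicial_complex (attach w Z Z).
Proof. exact: attach_complex. Qed.
Let link_del : attach w Z Y \subset attach w Z Z.
Proof. exact: attach_sub. Qed.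
Let vdel : avoids v (attach w Z Z). Proof. exact: avoids_attach. Qed.

Lemma lift_complex : simplicial_complex (lift v w Y Z).
Proof. exact: attach_complex. Qed.

Lemma lift_nonevasive :
  nonevasive Y -> nonevasive Z -> nonevasive (lift v w Y Z).
Proof.
move=> nY nZ; have [[Y0 _] [Z0 _]] := (Ycx, Zcx).
apply: nonevasive_attach => //; first by case: linkcx.
  exact: nonevasive_attach.
exact: nonevasive_attach.
Qed.

(** Here [attach w Z Z] is the full cone w*Z. Its faces without [w] extend by [w] and lie in [Z],
    hence in [attach w Z Y]; for faces through [w] the claim reduces to [YZ]. *)
Lemma cone_covers : covers (attach w Z Y) (attach w Z Z).
Proof.
split=> // s.
  rewrite inE; case: ifP => ws sL; last first.
    by exists (w |: s); rewrite ?attach_cone ?proper_setU1 ?ws.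
  have [_ /(_ _ sL)[t tZ st] _] := YZ; exists (w |: t).
    by rewrite attach_cone ?wZ.
  by rewrite (proper_setD1S ws) ?setU11 // setU1K ?wZ.
have [ws|ws] := boolP (w \in s).
  by rewrite free_attach_cone // [_ \in attach _ _ _]inE ws; case: YZ => _ _; apply.
by case/andP; rewrite !attach_base.
Qed.

Lemma free_lift s :
  free_face (lift v w Y Z) s =
  [&& v \in s, w \in s & free_face Y (s :\ v :\ w)].
Proof.
rewrite (free_attach _ vdel linkcx cone_covers).
by rewrite (free_attach _ wZ Ycx YZ) !inE wv.
Qed.

Lemma lift_adjacent_free : adjacent_free Y -> adjacent_free (lift v w Y Z).
Proof.
have vlink : avoids v (attach w Z Y) by apply: avoids_attach.
move=> aY; apply: (adjacent_free_cone vlink) => [s sL|s|].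
- by rewrite attach_cone ?vlink.
- exact: (free_attach _ vdel linkcx cone_covers).
apply: (adjacent_free_cone wY _ _ aY) => [s sY|s].
  by rewrite attach_cone ?wY.
exact: free_attach.
Qed.


Lemma mem_midlift s :
  (s \in midlift v w X Y Z) =
  (s :\ v :\ w \in if w \in s then X else if v \in s then Y else Z).
Proof.
rewrite setD1C mem_attach; case: (w \in s); rewrite mem_attach !inE vw //=.
by case: ifP.
Qed.

(** A face through both apexes cannot gain an apex, so it inherits a coface from [Y]. *)
Lemma cofaces_lift s t :
  v \in s -> w \in s -> t \in Y -> s :\ v :\ w \proper t ->
  exists2 t', t' \in lift v w Y Z & s \proper t'.
Proof.
move=> vs ws tY st; exists (v |: (w |: t)).
  by rewrite mem_lift // !inE !eqxx orbT /= !setU1K ?wY // !inE negb_or vw vY.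
by rewrite -(setD1K vs) -[s :\ v](@setD1K _ w) ?inE ?wv //
  !proper_setU1S ?wY // !inE negb_or vw vY.
Qed.

(** A face that misses an apex extends by it, because [X] lies in [Y] and [Y] in [Z]; a face through
    both has its coface from [XY]. The free faces of the lift are both apexes joined to a free face
    of [Y], and those lie in [X]. *)
Lemma midlift_covers_lift : covers (midlift v w X Y Z) (lift v w Y Z).
Proof.
have ms s : s \in midlift v w X Y Z -> s \in lift v w Y Z.
  rewrite mem_lift // mem_midlift.
  case: (v \in s); case: (w \in s) => //=; first exact: (subsetP XsY).
    exact: (subsetP YsZ).
  by move/(subsetP XsY)/(subsetP YsZ).
split=> [|s|s]; first exact/subsetP.
- rewrite mem_midlift.
  have [vs|vs] := boolP (v \in s); last first.
    move=> sM; exists (v |: s); last exact: proper_setU1.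
    rewrite (setD1_id vs) in sM; rewrite mem_lift // setU11 setU1K // !inE (negPf wv) /=.
    by case: (w \in s) sM => //= /(subsetP XsY).
  have [ws|ws] := boolP (w \in s).
    by case: XY => _ XYp _ /XYp[t tY st]; apply: cofaces_lift st.
  move=> sM; exists (w |: s); last exact: proper_setU1.
  by rewrite mem_lift // setU11 !inE vs orbT /= setD1C setU1K // -(setD1_id ws) setD1C.
- rewrite free_lift => /and3P[vs ws] fs; rewrite mem_midlift ws.
  by case: XY => _ _; apply.
Qed.

Lemma lift_covers_lift : covers (lift v w X Y) (lift v w Y Z).
Proof.
have ms s : s \in lift v w X Y -> s \in lift v w Y Z.
  by rewrite !mem_lift //; case: ifP => _; [apply: (subsetP XsY)|apply: (subsetP YsZ)].
split=> [|s|s]; first exact/subsetP.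
- rewrite mem_lift //.
  have [vs|vs] := boolP (v \in s); last first.
    move=> sM; exists (v |: s); last exact: proper_setU1.
    rewrite (setD1_id vs) in sM; rewrite mem_lift // setU11 setU1K // !inE (negPf wv) /=.
    by case: (w \in s) sM => //= /(subsetP YsZ).
  have [ws|ws] := boolP (w \in s).
    by case: XY => _ XYp _ /= /XYp[t tY st]; apply: cofaces_lift st.
  move=> sM; exists (w |: s); last exact: proper_setU1.
  by rewrite mem_lift // setU11 !inE vs orbT /= setD1C setU1K // -(setD1_id ws) setD1C.
- rewrite free_lift => /and3P[vs ws] fs; rewrite mem_lift // vs ws.
  by case: XY => _ _; apply.
Qed.

Let midlink : simplicial_complex (attach v X X).
Proof. exact: attach_complex. Qed.
Let middel : simplicial_complex (attach v Z Y).
Proof. exact: attach_complex. Qed.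
Let wmid : avoids w (attach v Z Y). Proof. exact: avoids_attach. Qed.
Let midsub : attach v X X \subset attach v Z Y.
Proof. by apply: attach_sub => //; apply: subset_trans YsZ. Qed.

Lemma midlift_complex : simplicial_complex (midlift v w X Y Z).
Proof. exact: attach_complex. Qed.

(** The cone [attach v X X] is the link of [w]. Its non-evasiveness is a separate hypothesis because
    in the application [X] is two points, which is not non-evasive. *)
Lemma midlift_nonevasive :
  nonevasive Y -> nonevasive Z -> nonevasive (attach v X X) ->
  nonevasive (midlift v w X Y Z).
Proof.
move=> nY nZ nX; apply: nonevasive_attach => //; first by case: midlink.
by apply: nonevasive_attach => //; case: Ycx.
Qed.

Lemma midlink_covers : covers (attach v X X) (attach v Z Y).
Proof.
split=> // s; have [vs|vs] := boolP (v \in s).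
- rewrite [s \in _]inE vs => sX; case: XY => _ /(_ _ sX)[t tY st] _.
  exists (v |: t); first by rewrite attach_cone ?vY.
  by rewrite (proper_setD1S vs) ?setU11 // setU1K ?vY.
- rewrite attach_base // => sX; exists (v |: s); last exact: proper_setU1.
  by rewrite attach_cone // (subsetP XsY).
- by rewrite (free_attach _ vZ Ycx YZ) inE vs /=; case: XY => _ _; apply.
- by rewrite (free_attach _ vZ Ycx YZ) (negPf vs).
Qed.

Lemma free_midlift s :
  free_face (midlift v w X Y Z) s =
  (w \in s) && free_face (attach v X X) (s :\ w).
Proof. exact: (free_attach _ wmid midlink midlink_covers). Qed.

Lemma midlift_adjacent_free :
  adjacent_free (attach v X X) -> adjacent_free (midlift v w X Y Z).
Proof.
have wlink : avoids w (attach v X X) by exact: avoids_attach.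
apply: (adjacent_free_cone wlink _ free_midlift) => s sL.
by rewrite /midlift attach_cone ?wlink.
Qed.

(** The free faces of the middle lift are [w |: s] with [s] free in v*X, and the hypothesis puts
    these [s] in [X]. For two points, v*X is a path whose free faces are its ends. *)
Lemma base_covers_midlift :
  (forall s, free_face (attach v X X) s -> s \in X) ->
  covers (attach w X X) (midlift v w X Y Z).
Proof.
move=> Xf; split=> [|s|s].
- apply: attach_sub; last exact: sub_attach.
  apply: subset_trans (sub_attach _ vZ).
  exact: subset_trans YsZ.
- move=> sX; have vs : v \notin s by apply: (avoids_attach vw vX vX).
  exists (v |: s); last exact: proper_setU1.
  move: sX; rewrite mem_attach mem_midlift setU11 setU1K // !inE (negPf wv) /=.
  by case: (w \in s) => //= /(subsetP XsY).
- by rewrite free_midlift [s \in _]inE => /andP[-> /Xf].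
Qed.

End Lift.

(** * Two points and the path that joins them *)

Section Pair.
Variables x y : T.
Hypothesis xy : x != y.

Definition endpoints : {set {set T}} := [set set0; [set x]; [set y]].

Lemma endpointsP s :
  reflect [\/ s = set0, s = [set x] | s = [set y]] (s \in endpoints).
Proof.
rewrite !inE; apply: (iffP orP) => [[/orP[]|] /eqP|[]] ->; rewrite ?eqxx ?orbT;
  by [constructor 1|constructor 2|constructor 3|left|right].
Qed.

Lemma subset1_cases (s : {set T}) z :
  s \subset [set z] -> s = set0 \/ s = [set z].
Proof. by rewrite subset1 => /orP[]/eqP; [right|left]. Qed.

Lemma endpoints_complex : simplicial_complex endpoints.
Proof.
split=> [|s t /endpointsP[] -> ]; first by rewrite !inE eqxx.
- by rewrite subset0 => /eqP ->; rewrite !inE eqxx.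
- by case/subset1_cases => ->; rewrite !inE eqxx ?orbT.
- by case/subset1_cases => ->; rewrite !inE eqxx ?orbT.
Qed.

Lemma endpoints_dimension : has_dimension endpoints 0.
Proof.
apply: dimension_intro => [s /endpointsP[] ->|]; rewrite ?cards0 ?cards1 //.
by exists [set x]; rewrite ?cards1 // !inE eqxx orbT.
Qed.

(** The empty face has two proper cofaces, and each point has none. *)
Lemma free_endpoints s : ~~ free_face endpoints s.
Proof.
rewrite negb_and -implybE; apply/implyP => /endpointsP sE.
have {sE} [->|sz] : s = set0 \/ exists z, s = [set z].
  by case: sE; [left|right; exists x|right; exists y].
  rewrite neq_ltn; apply/orP; right; apply/card_gt1P.
  exists [set x], [set y]; split;
    rewrite ?inE ?eqxx ?orbT ?proper0 -?cards_eq0 ?cards1 //.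
  by rewrite (inj_eq set1_inj).
rewrite neq_ltn ltnS leqn0 cards_eq0; apply/orP; left; apply/eqP/setP => t.
rewrite inE in_set0; case: sz => z ->; apply/negP => /andP[tE /proper_card].
by rewrite cards1 ltnNge (dimension_leq endpoints_dimension).
Qed.

Variable r : T.
Hypothesis rE : avoids r endpoints.

Let rx : r != x.
Proof. by have := @rE [set x]; rewrite !inE eqxx orbT => /(_ isT). Qed.
Let ry : r != y.
Proof. by have := @rE [set y]; rewrite !inE eqxx !orbT => /(_ isT). Qed.

(** The path x, r, y, seen as the cone from [r] over its ends. *)
Definition arc := attach r endpoints endpoints.

(** [free_attach] does not apply, since the points are facets of [endpoints]. Faces through [r]
    correspond to faces of [endpoints], none of them free; the empty face has several cofaces; each
    end lies in one edge only. *)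
Lemma free_arc s : free_face arc s = (s \in [set [set x]; [set y]]).
Proof.
have [sE|sE] := boolP (s \in endpoints); last first.
  have -> : (s \in [set [set x]; [set y]]) = false.
    by apply: contraNF sE => /set2P[] ->; rewrite !inE eqxx ?orbT.
  have [rs|rs] := boolP (r \in s).
    by rewrite free_attach_cone // (negPf (free_endpoints _)).
  by rewrite (free_attach_base rE endpoints_complex rs sE) (negPf (free_endpoints _)).
have rs := rE sE.
have [s0|[z sz]] : s = set0 \/ exists z, s = [set z].
  by case/endpointsP: (sE); [left|right; exists x|right; exists y].
  have -> : (s \in [set [set x]; [set y]]) = false.
    by rewrite s0 !inE !(eq_sym set0) -!cards_eq0 !cards1.
  apply/negbTE/(@free_attach_link _ _ _ _ [set x]) => //.
    by rewrite !inE eqxx orbT.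
  by rewrite s0 proper0 -card_gt0 cards1.
have -> : s \in [set [set x]; [set y]].
  by move: sE; rewrite !inE sz -cards_eq0 cards1.
rewrite /free_face attach_base // sE /=; apply/cards1P; exists (r |: s).
apply/setP => t; rewrite in_set1 inE; apply/andP/eqP => [[]|->]; last first.
  by rewrite attach_cone // proper_setU1.
rewrite inE; case: ifP => [rt tE st|_ tE /proper_card]; last first.
  by rewrite sz cards1 ltnNge (dimension_leq endpoints_dimension).
rewrite -(setD1K rt); congr (_ |: _); apply/esym/eqP.
by rewrite eqEcard subsetD1 proper_sub // rs sz cards1
  (dimension_leq endpoints_dimension).
Qed.

Lemma arc_adjacent_free : adjacent_free arc.
Proof.
exists [set x], [set y]; split; first by rewrite (inj_eq set1_inj).
  by apply/setP => s; rewrite inE free_arc.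
by exists set0;
  rewrite /codim1_face !sub0set !cards1 cards0 !attach_base ?rE ?inE ?eqxx ?orbT.
Qed.

Lemma nonevasive_attach_point v z D :
  avoids v D -> set0 \in D -> [set z] \in D -> nonevasive D ->
  nonevasive (attach v D [set set0; [set z]]).
Proof.
move=> vD D0 Dz nD; apply: nonevasive_attach => //.
- by apply/subsetP => s /set2P[] ->.
- exact: set21.
- exact: nonevasive_point.
Qed.

(** Two points are not non-evasive, so the cone presentation does not show that the path is. The
    path is rebuilt from the vertex [r] by attaching [x] and then [y], each over [r] alone. *)
Lemma arcE : arc = attach y (attach x [set set0; [set r]] [set set0; [set r]])
  [set set0; [set r]].
Proof.
have yx : y != x by rewrite eq_sym.
have xr : x != r by rewrite eq_sym.
have yr : y != r by rewrite eq_sym.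
have C1 (u z : T) : u |: [set z] = [set z; u] by rewrite setUC.
apply/setP => s; apply/idP/idP.
  have [rs|rs] := boolP (r \in s); rewrite mem_attach ?rs ?(negPf rs).
    move/endpointsP => sE; rewrite -(setD1K rs); case: sE => ->.
    - by rewrite setU0 !attach_base ?set22 // !inE.
    - by rewrite setUC attach_base ?attach_cone ?set22 // !inE ?negb_or ?yx.
    - by rewrite setUC attach_cone ?set22 // !inE.
  rewrite setD1_id // => /endpointsP[] ->.
  - by rewrite !attach_base ?inE ?eqxx.
  - by rewrite -[[set x]]setU0 attach_base ?attach_cone ?set21 // !inE ?orbF.
  - by rewrite -[[set y]]setU0 attach_cone ?set21 // !inE.
have endr : r |: set0 \in arc by rewrite attach_cone ?inE ?eqxx.
have base z : z \in [set x; y] -> z |: set0 \in arc /\ z |: [set r] \in arc.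
  move=> zE; have zB : [set z] \in endpoints.
    by case/set2P: zE => ->; rewrite !inE eqxx ?orbT.
  by rewrite setU0 attach_base ?rE // C1 attach_cone ?rE.
have arc0 : set0 \in arc by rewrite attach_base !inE ?eqxx.
have [ys|ys] := boolP (y \in s); rewrite mem_attach ?ys ?(negPf ys).
  by rewrite -{2}(setD1K ys) => /set2P[] ->; case: (base y); rewrite ?set22.
rewrite setD1_id //; have [xs|xs] := boolP (x \in s); rewrite mem_attach ?xs ?(negPf xs).
  by rewrite -{2}(setD1K xs) => /set2P[] ->; case: (base x); rewrite ?set21.
by rewrite setD1_id // => /set2P[] ->; rewrite // -[[set r]]setU0.
Qed.

Lemma arc_nonevasive : nonevasive arc.
Proof.
rewrite arcE; apply: nonevasive_attach_point.
- apply: avoids_attach => [|s|s]; first by rewrite eq_sym.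
    by move=> /set2P[] ->; rewrite !inE // eq_sym.
  by move=> /set2P[] ->; rewrite !inE // eq_sym.
- by rewrite attach_base !inE ?eqxx.
- by rewrite attach_base !inE ?eqxx ?orbT // eq_sym.
apply: nonevasive_attach_point; rewrite ?set21 ?set22 //.
  by move=> s /set2P[] ->; rewrite !inE // eq_sym.
exact: nonevasive_point.
Qed.

End Pair.

(** * Towers and their lifts *)

(** Two clauses start at index 1: two points are not non-evasive and have no free face. *)
Record tower x y (n : nat) (A : nat -> {set {set T}}) : Prop := Tower {
  tower0 : A 0 = endpoints x y;
  tower_complex : forall i, i <= n -> simplicial_complex (A i);
  tower_dimension : forall i, i <= n -> has_dimension (A i) i;
  tower_nonevasive : forall i, 0 < i <= n -> nonevasive (A i);
  tower_adjacent : forall i, 0 < i <= n -> adjacent_free (A i);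
  tower_covers : forall i, i < n -> covers (A i) (A i.+1)
}.

(** The last branch only sees [j] at least 1, so in a tower both complexes given to [lift] are
    non-evasive. *)
Definition lift_tower v w (A : nat -> {set {set T}}) (i : nat) :=
  match i with
  | 0 => A 0
  | 1 => attach w (A 0) (A 0)
  | 2 => midlift v w (A 0) (A 1) (A 2)
  | j.+2 => lift v w (A j) (A j.+1)
  end.

Lemma tower_lift x y n A v w :
  x != y -> 1 < n -> tower x y n A -> v != w ->
  (forall i, i <= n -> avoids v (A i)) ->
  (forall i, i <= n -> avoids w (A i)) ->
  tower x y n.+1 (lift_tower v w A).
Proof.
move=> xy n1 [A0 Acx Adim Ane Aadj Acov] vw vA wA.
have n0 := ltnW n1.
have vE : avoids v (endpoints x y) by rewrite -A0; apply: vA.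
have wE : avoids w (endpoints x y) by rewrite -A0; apply: wA.
(* Both cones over [A 0] are paths: the one from [w] is the new stage 1, the one from [v] is the
   link of [w] in the new stage 2. *)
have [vn wn an bn] : [/\ nonevasive (attach v (A 0) (A 0)),
    nonevasive (attach w (A 0) (A 0)), adjacent_free (attach v (A 0) (A 0)) &
    adjacent_free (attach w (A 0) (A 0))].
  by rewrite A0; split; try exact: arc_nonevasive; exact: arc_adjacent_free.
have fA (u : T) s : avoids u (A 0) -> free_face (attach u (A 0) (A 0)) s -> s \in A 0.
  by rewrite A0 => uE; rewrite free_arc // !inE -orbA => ->; rewrite orbT.
have {}Ane i : i < n -> nonevasive (A i.+1) by move=> lin; apply: Ane.
have {}Aadj i : i < n -> adjacent_free (A i.+1) by move=> lin; apply: Aadj.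
have wv : w != v by rewrite eq_sym.
split=> //.
- case=> [|[|[|i]]] /= li; first exact: Acx.
  + by apply: attach_complex; auto.
  + by apply: midlift_complex; auto.
  + by apply: lift_complex; auto using ltnW.
- case=> [|[|[|i]]] /= li; first exact: Adim.
  + by apply: attach_dimension; auto.
  + apply: (@attach_dimension _ _ _ 2 1) => //.
    * by apply: avoids_attach; auto.
    * by apply: (@attach_dimension _ _ _ 2 1); auto.
    * by apply: attach_dimension; auto.
  (* Used with [j] equal to i+2 and i+1, for the deletion and the link of [v] in the lift. *)
  + have dim j : i.+1 <= j -> j <= i.+2 ->
        has_dimension (attach w (A i.+2) (A j)) j.+1.
      move=> ij ji; have jn := leq_trans ji li.
      by apply: (@attach_dimension _ _ _ i.+2); auto.
    apply: (@attach_dimension _ _ _ i.+3) => //; try exact: dim.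
    by apply: avoids_attach; auto using ltnW.
- case=> [|[|[|i]]] //= li.
  + by apply: midlift_nonevasive; auto.
  + by apply: lift_nonevasive; auto using ltnW.
- case=> [|[|[|i]]] //= li.
  + by apply: midlift_adjacent_free; auto.
  + by apply: lift_adjacent_free; auto using ltnW.
- case=> [|[|[|i]]] /= li.
  + split=> [|s sE|s]; first by apply: sub_attach; auto.
      exists (w |: s); first by rewrite attach_cone // (wA 0).
      by apply: proper_setU1; rewrite (wA 0).
    by apply: fA; auto.
  + apply: base_covers_midlift; auto.
    by move=> s; apply: (fA v); auto.
  + by apply: midlift_covers_lift; auto.
  + by apply: lift_covers_lift; auto using ltnW.
Qed.

Lemma lift_tower_avoids n A v w z :
  1 < n -> z != v -> z != w -> (forall i, i <= n -> avoids z (A i)) ->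
  forall i, i <= n.+1 -> avoids z (lift_tower v w A i).
Proof.
move=> n1 zv zw zA [|[|[|i]]] li /=; rewrite /midlift /lift;
  repeat (apply: avoids_attach => //); apply: zA => //; exact: ltnW.
Qed.

End Attach.

(** * Complexes given by lists of faces *)

Section ListComplex.
Variables (N M : nat).
Hypothesis MN : M <= N.
Implicit Types (l t : seq nat) (F : seq (seq nat)).

(** Entries not below [N] are dropped silently, hence the bounds on entries in later lemmas. *)
Definition face_of l : {set 'I_N} := [set i : 'I_N | (i : nat) \in l].

Definition complex_of F : {set {set 'I_N}} := [set s : {set 'I_N} | s \in map face_of F].

Lemma complex_ofP F s :
  reflect (exists2 l, l \in F & s = face_of l) (s \in complex_of F).
Proof. by rewrite inE; apply: mapP. Qed.

Lemma face_of_mem F l : l \in F -> face_of l \in complex_of F.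
Proof. by move=> lF; apply/complex_ofP; exists l. Qed.

Lemma face_of_subset l t :
  all (ltn^~ N) l -> (face_of l \subset face_of t) = all (mem t) l.
Proof.
move=> /allP lN; apply/subsetP/allP => [lt i il|lt i].
  by have := lt (Ordinal (lN i il)); rewrite !inE; apply.
by rewrite !inE => /lt.
Qed.

Fixpoint sublists l : seq (seq nat) :=
  if l is i :: l' then sublists l' ++ map (cons i) (sublists l') else [:: [::]].

Lemma filter_sublists (P : pred nat) l : [seq i <- l | P i] \in sublists l.
Proof.
elim: l => //= i l IH; rewrite mem_cat; case: (P i); last by rewrite IH.
by rewrite map_f ?orbT.
Qed.

Definition closed_list F := ([::] \in F) && all (fun l => all (mem F) (sublists l)) F.

(** A subset of [face_of l] is the face of a filtered copy of [l], which is among the sublists of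
    [l]. *)
Lemma complex_of_complex F : closed_list F -> simplicial_complex (complex_of F).
Proof.
case/andP=> F0 /allP Fc; split=> [|s _ /complex_ofP[l lF ->] sl].
  by apply/complex_ofP; exists [::] => //; apply/setP => i; rewrite !inE.
have -> : s = face_of [seq i <- l | i \in [seq val j | j in s]].
  apply/setP => i; rewrite inE mem_filter mem_image; last exact: val_inj.
  by apply/idP/andP => [si|[]//]; split=> //; have := subsetP sl i si; rewrite inE.
apply: face_of_mem; exact: (allP (Fc l lF)) (filter_sublists _ l).
Qed.

Definition link_list F (v : nat) := [seq [seq i <- l | i != v] | l <- F & v \in l].

Definition deletion_list F (v : nat) := [seq l <- F | v \notin l].

Lemma face_of_filter l (v : 'I_N) :
  face_of [seq i <- l | i != v :> nat] = face_of l :\ v.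
Proof. by apply/setP => i; rewrite !inE mem_filter. Qed.

Lemma link_complex_of F (v : 'I_N) :
  simplicial_complex (complex_of F) ->
  link (complex_of F) v = complex_of (link_list F v).
Proof.
move=> [_ Fc]; apply/setP => s; rewrite inE; apply/and3P/complex_ofP.
  case=> _ vs /complex_ofP[l lF sl]; exists [seq i <- l | i != v :> nat].
    apply: map_f; rewrite mem_filter lF andbT.
    by have := setU11 v s; rewrite sl inE.
  by rewrite face_of_filter -sl setU1K.
case=> _ /mapP[l + ->] ->; rewrite mem_filter => /andP[vl lF].
have lC := face_of_mem lF; have vf : v \in face_of l by rewrite inE.
rewrite face_of_filter setD1K //.
by split=> //; [exact: Fc lC (subsetDl _ _)|rewrite !inE eqxx].
Qed.

Lemma deletion_complex_of F (v : 'I_N) :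
  deletion (complex_of F) v = complex_of (deletion_list F v).
Proof.
apply/setP => s; rewrite inE; apply/andP/complex_ofP.
  case=> /complex_ofP[l lF ->] vl; exists l => //.
  by rewrite mem_filter lF andbT; move: vl; rewrite inE.
case=> l; rewrite mem_filter => /andP[vl lF] ->.
by rewrite face_of_mem // inE.
Qed.

(** * A computable test for non-evasiveness *)

(** Vertices are searched below [M], which can be a numeral, so the test computes while [N] stays a
    variable. *)
Definition point_list F :=
  has (fun v => [&& all (mem [:: [::]; [:: v]]) F, [::] \in F & [:: v] \in F])
    (iota 0 M).

(** The argument [k] is fuel: each recursive call removes a vertex. *)
Fixpoint nonevasive_list k F : bool :=
  point_list F ||
  if k is k'.+1 then
    has (fun v => [&& [:: v] \in F,
        has (fun u => (u != v) && ([:: u] \in F)) (iota 0 M),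
        nonevasive_list k' (link_list F v) &
        nonevasive_list k' (deletion_list F v)]) (iota 0 M)
  else false.

Lemma face_of0 : face_of [::] = set0.
Proof. by apply/setP => i; rewrite !inE. Qed.

Lemma face_of1 (v : 'I_N) : face_of [:: v : nat] = [set v].
Proof. by apply/setP => i; rewrite !inE. Qed.

(** Closure under subsets identifies the link of the list with the link of the complex. It passes to
    the recursive calls through the complexes, not through the lists. *)
Lemma nonevasive_listP k F :
  simplicial_complex (complex_of F) -> nonevasive_list k F ->
  nonevasive (complex_of F).
Proof.
have iN v : v \in iota 0 M -> v < N.
  by rewrite mem_iota add0n => /leq_trans; apply.
have point G : point_list G -> nonevasive (complex_of G).
  case/hasP=> v0 /iN vN; pose v : 'I_N := Ordinal vN.
  rewrite -[v0]/(val v) => /and3P[/allP Gv G0 G1].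
  suff -> : complex_of G = [set set0; [set v]] by exact: nonevasive_point.
  rewrite -face_of0 -face_of1; apply/setP => s; apply/complex_ofP/set2P.
    by case=> l /Gv; rewrite !inE => /orP[]/eqP -> ->; [left|right].
  by case=> ->; [exists [::]|exists [:: v : nat]].
elim: k F => [|k IH] F Fc /=; first by rewrite orbF; apply: point.
case/orP; first exact: point.
case/hasP=> v0 /iN vN; pose v : 'I_N := Ordinal vN.
rewrite -[v0]/(val v) => /and4P[Fv /hasP[u0 /iN uN /andP[uv Fu]] lF dF].
have vC : v \in vertices (complex_of F) by rewrite inE -face_of1 face_of_mem.
apply: (nonevasive_step (v := v)) => //.
- apply/card_gt1P; exists (Ordinal uN), v; split=> //.
  by rewrite inE -face_of1 face_of_mem.
- rewrite link_complex_of //; apply: IH lF.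
  by rewrite -link_complex_of //; apply: link_complex.
- rewrite deletion_complex_of; apply: IH dF.
  by rewrite -deletion_complex_of; apply: deletion_complex.
Qed.

Definition proper_list l t := all (mem t) l && ~~ all (mem l) t.

(** Counting lists counts faces as soon as distinct lists of [F] have distinct sets of entries. *)
Lemma free_complex_of F l :
  all (all (ltn^~ N)) F -> uniq F ->
  {in F &, forall l t, all (mem t) l -> all (mem l) t -> l = t} ->
  l \in F ->
  free_face (complex_of F) (face_of l) = (count (proper_list l) F == 1).
Proof.
move=> /allP FN Fu Fa lF; rewrite /free_face face_of_mem //=.
have -> : [set t in complex_of F | face_of l \proper t] =
    [set s in map face_of [seq t <- F | proper_list l t]].
  have pE t : t \in F -> (face_of l \proper face_of t) = proper_list l t.
    by move=> tF; rewrite properE !face_of_subset ?FN.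
  apply/setP => s; rewrite !inE; apply/andP/mapP => [[/mapP[t tF ->]]|[t + ->]].
    by rewrite pE // => lt; exists t; rewrite // mem_filter lt.
  by rewrite mem_filter => /andP[lt tF]; rewrite map_f ?pE.
rewrite cardsE (card_uniqP _) ?size_map ?size_filter //.
rewrite map_inj_in_uniq ?filter_uniq // => t1 t2.
rewrite !mem_filter => /andP[_ t1F] /andP[_ t2F] tt.
by apply: Fa => //; rewrite -face_of_subset ?FN // tt.
Qed.

Lemma card_face_of l : all (ltn^~ N) l -> uniq l -> #|face_of l| = size l.
Proof.
move=> lN lu; have -> : face_of l = [set i in pmap insub l].
  by apply/setP => i; rewrite !inE mem_pmap_sub.
rewrite cardsE (card_uniqP _) ?pmap_sub_uniq // size_pmap_sub.
by apply/eqP; rewrite -all_count.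
Qed.
End ListComplex.

(* Obtained from the edge 01 by coning from 2, 3, 4, 5 in turn over the paths
   01, 120, 3102 and 0342; the free edges left are 05 and 25. *)
Definition base_facets : seq (seq nat) :=
  [:: [:: 0; 1; 2]; [:: 1; 2; 3]; [:: 0; 2; 3]; [:: 1; 3; 4]; [:: 0; 1; 4];
      [:: 0; 2; 4]; [:: 3; 4; 5]; [:: 0; 3; 5]; [:: 2; 4; 5]].

(** Facets are written in increasing order, so a face shared by several facets yields equal lists
    and [undup] keeps one list per face. *)
Definition base_faces : seq (seq nat) :=
  undup (flatten (map sublists base_facets)).

Definition arc_faces : seq (seq nat) :=
  [:: [::]; [:: 0]; [:: 2]; [:: 5]; [:: 0; 5]; [:: 2; 5]].

(** * The base complex on six vertices and the towers built from it *)

Section Base.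
Variable N : nat.
Hypothesis N6 : 6 <= N.

(** The free edges 05 and 25 meet in 5, so their path has ends 0 and 2 and middle vertex 5. *)
Let x : 'I_N := Ordinal (leq_trans (isT : 0 < 6) N6).
Let y : 'I_N := Ordinal (leq_trans (isT : 2 < 6) N6).
Let r : 'I_N := Ordinal (leq_trans (isT : 5 < 6) N6).

Let rE : avoids r (endpoints x y).
Proof. by move=> s /endpointsP[] ->; rewrite !inE. Qed.

Let base_lt : all (all (ltn^~ N)) base_faces.
Proof.
(* The bound is computed for the numeral 6 and then weakened to the variable [N]. *)
have : all (all (ltn^~ 6)) base_faces by vm_compute.
by apply: sub_all => l; apply: sub_all => i /leq_trans; apply.
Qed.

Let base_complexP : simplicial_complex (complex_of N base_faces).
Proof. by apply: complex_of_complex; vm_compute. Qed.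

Lemma base_nonevasive : nonevasive (complex_of N base_faces).
(* One unit of fuel per vertex is enough. *)
Proof. by apply: (nonevasive_listP (k := 6) N6) => //; vm_compute. Qed.

Lemma base_dimension : has_dimension (complex_of N base_faces) 2.
Proof.
have su : all (fun l => uniq l && (size l <= 3)) base_faces by vm_compute.
have card l : l \in base_faces -> #|face_of N l| = size l.
  move=> lF; have /andP[lu _] := allP su l lF.
  by rewrite card_face_of // (allP base_lt).
apply: dimension_intro => [_ /complex_ofP[l lF ->]|].
  by rewrite card //; case/andP: (allP su l lF).
exists (face_of N [:: 0; 1; 2]); last by rewrite card //; vm_compute.
by apply: face_of_mem; vm_compute.
Qed.

Lemma free_base l : l \in base_faces ->
  free_face (complex_of N base_faces) (face_of N l) =
  (l \in [:: [:: 0; 5]; [:: 2; 5]]).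
Proof.
(* No two lists have the same entries, so lists may be counted instead of faces; the second table
   evaluates that count on every face. *)
have inj : all (fun l => all (fun t => all (mem t) l ==> all (mem l) t ==> (l == t))
    base_faces) base_faces by vm_compute.
have cnt : all (fun l => (count (proper_list l) base_faces == 1) ==
    (l \in [:: [:: 0; 5]; [:: 2; 5]])) base_faces by vm_compute.
move=> lF; have /eqP <- := allP cnt l lF.
apply: free_complex_of lF; [exact: base_lt|exact: undup_uniq|].
move=> l1 t1 l1F t1F lt tl; apply/eqP.
by have /implyP/(_ lt)/implyP/(_ tl) := allP (allP inj l1 l1F) t1 t1F.
Qed.

(** Turns faces of the path into lists, so that most of the covering condition becomes a finite
    computation. *)
Lemma arc_list s : s \in arc x y r -> exists2 l, l \in arc_faces & s = face_of N l.
Proof.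
have ord2 (i j : 'I_N) : j |: [set i] = face_of N [:: i : nat; j : nat].
  by apply/setP => k; rewrite !inE orbC.
rewrite mem_attach; case: ifP => rs; last first.
  rewrite setD1_id ?rs // => /endpointsP[] ->; rewrite -?face_of0 -?face_of1.
  + by exists [::].
  + by exists [:: 0].
  + by exists [:: 2].
rewrite -{2}(setD1K rs) => /endpointsP[] ->; rewrite ?setU0 ?ord2 -?face_of1.
+ by exists [:: 5].
+ by exists [:: 0; 5].
+ by exists [:: 2; 5].
Qed.

Lemma free_base_arc s : free_face (complex_of N base_faces) s -> s \in arc x y r.
Proof.
move=> fs; have /complex_ofP[l lF sl] : s \in complex_of N base_faces.
  by case/andP: fs.
have in2 z : z \in endpoints x y -> r |: z \in arc x y r.
  by move=> zE; rewrite attach_cone // rE.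
move: fs; rewrite sl free_base // in_cons mem_seq1 => /orP[]/eqP ->.
  have -> : face_of N [:: 0; 5] = r |: [set x].
    by apply/setP => i; rewrite !inE orbC.
  by apply: in2; rewrite !inE eqxx orbT.
have -> : face_of N [:: 2; 5] = r |: [set y].
  by apply/setP => i; rewrite !inE orbC.
by apply: in2; rewrite !inE eqxx orbT.
Qed.

Lemma base_adjacent_free : adjacent_free (complex_of N base_faces).
Proof.
have card l : all (ltn^~ 6) l -> uniq l -> #|face_of N l| = size l.
  move=> l6; apply: card_face_of; apply: sub_all l6 => i /leq_trans; exact.
exists (face_of N [:: 0; 5]), (face_of N [:: 2; 5]); split.
(* Vertex 0 lies in the first edge only. *)
- by apply/eqP => /setP/(_ x); rewrite !inE.
- apply/setP => s; rewrite inE; apply/idP/set2P => [fs|]; last first.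
    by case=> ->; rewrite free_base //; vm_compute.
  have /complex_ofP[l lF sl] : s \in complex_of N base_faces by case/andP: fs.
  move: fs; rewrite sl free_base // in_cons mem_seq1 => /orP[]/eqP ->; first by left.
  by right.
exists (face_of N [:: 5]).
have sub l : all (mem l) [:: 5] -> face_of N [:: 5] \subset face_of N l.
  by move=> l5; rewrite face_of_subset //= andbT.
have F5 : face_of N [:: 5] \in complex_of N base_faces.
  by apply: face_of_mem; vm_compute.
by split; apply/and3P; split; rewrite ?sub ?card.
Qed.

Lemma arc_covers_base : covers (arc x y r) (complex_of N base_faces).
Proof.
have cof : all (fun l => (l \in base_faces) && has (proper_list l) base_faces)
  arc_faces by vm_compute.
split; last exact: free_base_arc.
  apply/subsetP => _ /arc_list[l /(allP cof)/andP[lF _] ->].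
  exact: face_of_mem.
move=> _ /arc_list[l /(allP cof)/andP[lF /hasP[t tF lt]] ->].
exists (face_of N t); first exact: face_of_mem.
by rewrite properE !face_of_subset // (allP base_lt).
Qed.

Lemma base_tower : exists x0 y0 A,
  [/\ x0 != y0, tower x0 y0 2 A &
      forall v : 'I_N, 6 <= v -> forall i, i <= 2 -> avoids v (A i)].
Proof.
have xy : x != y by [].
pose A i := match i with 0 => endpoints x y | 1 => arc x y r
  | _ => complex_of N base_faces end.
have AS i : i <= 2 -> A i \subset complex_of N base_faces.
  have [sub _ _] := arc_covers_base.
  case: i => [|[|i]] // _; apply: subset_trans sub; exact: sub_attach.
have Ecx := endpoints_complex x y.
exists x, y, A; split=> //.
- split=> //.
  + case=> [|[|[|i]]] //= _; exact: attach_complex.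
  + case=> [|[|[|i]]] //= _; [exact: endpoints_dimension| |exact: base_dimension].
    by apply: (@attach_dimension _ _ _ _ 0 0) => //; exact: endpoints_dimension.
  + case=> [|[|[|i]]] //= _; [exact: arc_nonevasive|exact: base_nonevasive].
  + case=> [|[|[|i]]] //= _; [exact: arc_adjacent_free|exact: base_adjacent_free].
  + case=> [|[|i]] //= _; last exact: arc_covers_base.
    split=> [|s sE|s]; first exact: sub_attach.
      exists (r |: s); first by rewrite attach_cone ?rE.
      by rewrite proper_setU1 ?rE.
    by rewrite free_arc // !inE -orbA => ->; rewrite orbT.
(* All three stages lie in the base complex, whose vertices are below 6. *)
move=> v v6 i i2; apply: sub_avoids (AS i i2) _ => _ /complex_ofP[l lF ->].
have : all (all (ltn^~ 6)) base_faces by vm_compute.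
move=> /allP/(_ _ lF)/allP l6; rewrite inE; apply/negP => /l6.
by rewrite /= ltnNge v6.
Qed.

(* Each lift uses two fresh vertices. *)
Lemma tower_exists k : 6 + k.*2 <= N -> exists x0 y0 A,
  [/\ x0 != y0, tower x0 y0 k.+2 A &
      forall v : 'I_N, 6 + k.*2 <= v -> forall i, i <= k.+2 -> avoids v (A i)].
Proof.
elim: k => [|k IH] kN; first exact: base_tower.
have [|x0 [y0 [A [xy Atow Av]]]] := IH.
  by apply: leq_trans kN; rewrite leq_add2l leq_double.
have wN : 6 + k.*2.+1 < N by rewrite -addnS.
have vN : 6 + k.*2 < N by apply: ltnW; rewrite -addnS.
(* No stage so far has a vertex numbered 6 + 2k or more, so the next two numbers serve as apexes. *)
pose v := Ordinal vN; pose w := Ordinal wN.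
exists x0, y0, (lift_tower v w A); split=> //.
  apply: tower_lift => //; [|exact: Av|].
    by rewrite -val_eqE /= eqn_add2l neq_ltn ltnSn.
  by apply: Av; rewrite /= leq_add2l.
move=> z zk; apply: lift_tower_avoids => //.
- by rewrite -val_eqE /= gtn_eqF // -addnS (leq_trans _ zk) // leq_add2l.
- by rewrite -val_eqE /= gtn_eqF // -addnS.
- by apply: Av; rewrite (leq_trans _ zk) // leq_add2l leq_double.
Qed.

End Base.

Theorem theorem2p5 (d : nat) (hd : 1 <= d) :
  exists (T : finType) (E : {set {set T}}),
    [/\ simplicial_complex E, has_dimension E d, nonevasive E &
      exists s t : {set T},
        [/\ s != t,
            [set u | free_face E u] = [set s; t] &
            exists r : {set T}, codim1_face E r s /\ codim1_face E r t]].
Proof.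
(* The tower taken has last index d + 2 and lives on 6 + 2d vertices, so stage [d] is in range for
   small [d] as well. *)
have [x0 [y0 [A [_ Atow _]]]] := tower_exists (leq_addr d.*2 6) (leqnn (6 + d.*2)).
have dd : 0 < d <= d.+2 by rewrite hd !leqW.
exists 'I_(6 + d.*2), (A d); case: Atow => _ cx dim ne adj _; split.
- by apply: cx; rewrite !leqW.
- by apply: dim; rewrite !leqW.
- exact: ne.
- exact: adj.
Qed.
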